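(* Let $n$ and $t$ be positive integers with $t>\frac{1}{3}n^2+\frac{44}{9}n$, and let $C_t$ be the cycle on $t$ vertices. Then $f_{C_t}(n,n)=n$; that is, every collection of $n$ (not necessarily distinct) independent $n$-sets of $C_t$ has a rainbow independent $n$-set (and fewer than $n$ sets do not suffice).
   Context: For a collection $\mathcal{F}=(F_1,\dots,F_k)$ of sets (not necessarily distinct), a rainbow set of $\mathcal{F}$ is a set $\{x_{i_1},\dots,x_{i_m}\}$ of $m$ distinct elements with $i_1<\dots<i_m$ distinct indices in $[k]$ and $x_{i_j}\in F_{i_j}$. Given a graph $G$ and a collection $\mathcal{F}$ of independent sets of $G$, a rainbow independent set of $(\mathcal{F},G)$ is a rainbow set of $\mathcal{F}$ that is also independent in $G$; an $m$-set is a set of size $m$. For $m\le n$, $f_G(n,m)$ is the minimal number $k$ such that every collection of $k$ independent $n$-sets of $G$ has a rainbow independent $m$-set. *)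

(* Defs.v *)
From mathcomp Require Import all_boot all_order all_algebra.

Set Implicit Arguments.
Unset Strict Implicit.
Unset Printing Implicit Defensive.

Record sgraph := SGraph {
  vertex : finType;
  adj : rel vertex;
  adj_sym : symmetric adj;
  adj_irrefl : irreflexive adj }.

(* [ordS i] is i + 1 mod t.  The conjunct [i != j] only matters for t = 1,
   where it removes the loop; for t >= 3 this is the usual t-cycle. *)
Definition cycle_adj (t : nat) : rel 'I_t :=
  fun i j => (i != j) && ((j == ordS i) || (i == ordS j)).

Lemma cycle_adj_sym t : symmetric (@cycle_adj t).
Proof. by move=> i j; rewrite /cycle_adj eq_sym orbC. Qed.

Lemma cycle_adj_irrefl t : irreflexive (@cycle_adj t).
Proof. by move=> i; rewrite /cycle_adj eqxx. Qed.

Definition cycle_graph (t : nat) : sgraph :=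
  SGraph (@cycle_adj_sym t) (@cycle_adj_irrefl t).

Definition independent (G : sgraph) (S : {set vertex G}) : Prop :=
  {in S &, forall x y, ~~ adj x y}.

(* The family F is indexed, so its members may repeat. *)
Definition rainbow_set (T : finType) (k : nat) (F : 'I_k -> {set T})
    (S : {set T}) : Prop :=
  exists (m : nat) (i : 'I_m -> 'I_k) (x : 'I_m -> T),
    [/\ forall a b : 'I_m, a < b -> i a < i b,
        injective x,
        forall j : 'I_m, x j \in F (i j)
      & S = [set x j | j : 'I_m]].

Definition rainbow_property (G : sgraph) (n m k : nat) : Prop :=
  forall F : 'I_k -> {set vertex G},
    (forall i, independent (F i) /\ #|F i| = n) ->
    exists S : {set vertex G},
      [/\ rainbow_set F S, independent S & #|S| = m].

(* [is_rainbow_f G n m k] means f_G(n, m) = k: the graph of the partial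
   function sending (G, n, m) to the least k with [rainbow_property G n m k]. *)
Definition is_rainbow_f (G : sgraph) (n m k : nat) : Prop :=
  rainbow_property G n m k /\
  (forall j : nat, j < k -> ~ rainbow_property G n m j).

(* Main.v *)
Require Import Defs.
From mathcomp Require Import all_boot all_order all_algebra.
From mathcomp Require Import zify lra.

(** On a path the greedy choice (leftmost available vertex first) finds a full
rainbow independent set, so we are done if some vertex [x] is in no [F i].
Otherwise it suffices to find vertices [x], [y] of different colours, not
adjacent, such that each [F i] meets the closed neighbourhoods [N[x]] and
[N[y]] in at most two vertices altogether: take [x] and [y], and complete
greedily on the path that remains.  Since [F i] meets [N[x]] in at most two
vertices, a pair violated by [i] has [#|F i :&: N[x]| * #|F i :&: N[y]| >= 2],
and double counting shows that there are too few bad pairs: otherwise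
[2 t^2 <= 9 n^3 + 2 n^3 + 6 t]. *)

Import Order.TTheory GRing.Theory Num.Theory.

Set Implicit Arguments.
Unset Strict Implicit.
Unset Printing Implicit Defensive.

(** * Greedy choice by position *)

(** Serve first the colour of a vertex [x] of least position, and drop all vertices at positions up
    to [(pos x).+1]. Every other set loses at most one vertex while one colour is settled, so the
    size hypothesis survives. *)
Lemma greedy_separated (I T : finType) (x0 : T) (pos : T -> nat)
    (K : {set I}) (G : I -> {set T}) :
  (forall i, i \in K -> #|K| <= #|G i|) ->
  (forall i, i \in K -> {in G i &, forall x y, pos x <= pos y <= (pos x).+1 -> x = y}) ->
  exists g : I -> T, (forall i, i \in K -> g i \in G i) /\
    {in K &, forall i j, pos (g i) <= pos (g j) <= (pos (g i)).+1 -> i = j}.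
Proof.
elim: {K}#|K| {-2}K (erefl #|K|) G => [|m IH] K cardK G cardG sepG.
  (* [x0] is a default value for colours outside [K], here all of them. *)
  exists (fun=> x0); move/eqP: cardK; rewrite cards_eq0 => /eqP->.
  by split=> [i|i j]; rewrite inE.
have /card_gt0P[i0 i0K] : 0 < #|K| by rewrite cardK.
have /card_gt0P[y0 y0G] : 0 < #|G i0| by have := cardG _ i0K; rewrite cardK; apply: leq_trans.
pose P (p : I * T) := (p.1 \in K) && (p.2 \in G p.1).
have P0 : P (i0, y0) by rewrite /P i0K.
case: (arg_minnP (fun p => pos p.2) P0) => -[i x] /andP[/= iK xG] minx.
have ltx j y : j \in K -> y \in G j -> pos x <= pos y.
  by move=> jK yG; apply: (minx (j, y)); rewrite /P jK.
pose G' j := [set y in G j | (pos x).+1 < pos y].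
have [||j jK|g [gG gsep]] := IH (K :\ i) _ G'.
- by have := cardsD1 i K; rewrite iK cardK add1n => -[].
- move=> j /setD1P[_ jK].
  have -> : #|K :\ i| = m by have := cardsD1 i K; rewrite iK cardK add1n => -[].
  have := cardG _ jK; rewrite cardK -(cardsID [set y | (pos x).+1 < pos y] (G j)).
  have -> : G j :&: [set y | (pos x).+1 < pos y] = G' j by apply/setP=> y; rewrite !inE.
  (* All of [G j] lies at position [pos x] or later, so the dropped vertices occupy two consecutive
     positions, where a separated set has at most one element. *)
  have : #|G j :\: [set y | (pos x).+1 < pos y]| <= 1.
    apply/card_le1_eqP => y z; rewrite !inE -!leqNgt => /andP[ya yG] /andP[za zG].
    have := ltx _ _ jK yG; have := ltx _ _ jK zG => xz xy.
    case: (leqP (pos y) (pos z)) => yz; first apply/esym.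
      by apply: (sepG _ jK) => //; lia.
    by apply: (sepG _ jK) => //; lia.
  by lia.
- move: jK => /setD1P[_ jK] y z /[!inE] /andP[yG _] /andP[zG _]; exact: (sepG _ jK).
have g'P j : j \in K -> j != i -> g j \in G j /\ (pos x).+1 < pos (g j).
  move=> jK ji; have /gG : j \in K :\ i by rewrite !inE ji.
  by rewrite inE => /andP.
exists (fun j => if j == i then x else g j); split=> [j jK|j l jK lK].
  by case: (eqVneq j i) => [->//|/(g'P _ jK)[]].
case: (eqVneq j i) => [->|ji]; case: (eqVneq l i) => [->|li] //.
- by have [_] := g'P _ lK li; lia.
- by have [_] := g'P _ jK ji; lia.
- by apply: gsep; rewrite !inE ?ji ?li.
Qed.

(** * Cutting the cycle at a vertex *)

(** Number of forward steps from [v] to [u]; adding [t - v] avoids a truncated subtraction. *)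
Definition rot_pos t (v u : 'I_t) : nat := (u + (t - v)) %% t.

(** Excluding [v] turns the cycle into a path: the successor of the last vertex is [v], back at
    position 0. *)
Lemma rot_pos_step t (v u w : 'I_t) : w != v ->
  (w == ordS u) = (rot_pos v w == (rot_pos v u).+1).
Proof.
rewrite -!val_eqE /rot_pos /=; have := ltn_ord u; have := ltn_ord v; have := ltn_ord w.
move: (nat_of_ord u) (nat_of_ord v) (nat_of_ord w) => a b c ct bt at_ cb.
have E d : d < t -> (d + (t - b)) %% t = if d < b then d + (t - b) else d - b.
  move=> dt; case: ltnP => db; first by rewrite modn_small //; lia.
  have -> : d + (t - b) = (d - b) + t by lia.
  by rewrite modnDr modn_small //; lia.
rewrite !E //.
have [at1|at1] : a.+1 = t \/ a.+1 < t by lia.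
  have -> : a.+1 %% t = 0 by rewrite at1 modnn.
  by case: (ltnP a b); case: (ltnP c b); lia.
by rewrite (modn_small at1); case: (ltnP a b); case: (ltnP c b); lia.
Qed.

Lemma rot_pos_inj t (v : 'I_t) : injective (rot_pos v).
Proof.
move=> u w /eqP; rewrite /rot_pos eqn_modDr !modn_small ?ltn_ord // => /eqP.
exact: val_inj.
Qed.

Definition indep_cycle t (S : {set 'I_t}) :=
  {in S &, forall x y, ~~ cycle_adj x y}.

(** Opening the cycle at a vertex [v] that no set contains leaves a path, on which adjacency means
    consecutive positions; independent sets are then separated and the greedy choice applies. *)
Lemma rainbow_cycle_minus_vertex (I : finType) t (v : 'I_t) (K : {set I})
    (G : I -> {set 'I_t}) :
  (forall i, i \in K -> [/\ indep_cycle (G i), v \notin G i & #|K| <= #|G i|]) ->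
  exists g : I -> 'I_t, (forall i, i \in K -> g i \in G i) /\
    {in K &, forall i j, i != j -> (g i != g j) && ~~ cycle_adj (g i) (g j)}.
Proof.
move=> GP.
have [i /GP[] //|i /GP[indG vG _] x y xG yG|g [gG gsep]] :=
  @greedy_separated I _ v (rot_pos v) K G.
  have xv : x != v by apply: contraNneq vG => <-.
  have yv : y != v by apply: contraNneq vG => <-.
  rewrite [X in _ && X]leq_eqVlt andb_orr => /orP[/andP[_]|].
    rewrite -rot_pos_step // => yS; apply/eqP; apply: contraT => xy.
    by have := indG _ _ xG yG; rewrite /cycle_adj xy yS.
  by rewrite ltnS -eqn_leq => /eqP /rot_pos_inj.
exists g; split=> // i j iK jK ij.
have gv l : l \in K -> g l != v.
  by move=> lK; have [_ + _] := GP _ lK; apply: contraNneq => <-; apply: gG.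
have far l r : l \in K -> r \in K -> l != r -> ~~ (rot_pos v (g l) <= rot_pos v (g r) <= (rot_pos v (g l)).+1).
  by move=> lK rK; apply: contra_neqN; apply: gsep.
have := far _ _ iK jK ij; have := far _ _ jK iK; rewrite eq_sym => /(_ ij).
rewrite /cycle_adj (rot_pos_step _ (gv _ jK)) (rot_pos_step _ (gv _ iK)).
case: (eqVneq (g i) (g j)) => [->|_] /=; lia.
Qed.

(** * Closed neighbourhoods *)

Definition cnbhd t (x : 'I_t) : {set 'I_t} := [set y | (y == x) || cycle_adj x y].

Lemma cnbhdC t (x y : 'I_t) : (y \in cnbhd x) = (x \in cnbhd y).
Proof. by rewrite !inE eq_sym cycle_adj_sym. Qed.

Lemma cnbhd_sub t (x : 'I_t) : cnbhd x \subset x |: [set ordS x; ord_pred x].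
Proof.
apply/subsetP=> y; rewrite !inE /cycle_adj; case: eqP => //= _ /andP[_].
by case/orP=> [->//|/eqP->]; rewrite ordSK eqxx orbT.
Qed.

Lemma card_cnbhd t (x : 'I_t) : #|cnbhd x| <= 3.
Proof.
apply: leq_trans (subset_leq_card (cnbhd_sub x)) _.
by rewrite cardsU1 cards2; case: (_ \notin _); case: (_ != _).
Qed.

(** If [x] is in [S], none of its neighbours is; otherwise only the two neighbours of [x] can
    count. *)
Lemma card_indep_cnbhd t (S : {set 'I_t}) (x : 'I_t) :
  indep_cycle S -> #|S :&: cnbhd x| <= 2.
Proof.
move=> indS; have [xS|xS] := boolP (x \in S).
  apply: (@leq_trans #|[set x]|); last by rewrite cards1.
  apply/subset_leq_card/subsetP=> y; rewrite !inE => /andP[yS /orP[//|]].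
  by rewrite (negPf (indS _ _ xS yS)).
apply: (@leq_trans #|[set ordS x; ord_pred x]|); last by rewrite cards2; case: (_ != _).
apply/subset_leq_card/subsetP=> y /setIP[yS /(subsetP (cnbhd_sub x))].
by rewrite in_setU1 => /orP[/eqP yx|//]; rewrite yx (negPf xS) in yS.
Qed.

(** Double counting: by symmetry each [y] in [S] lies in at most three closed neighbourhoods. *)
Lemma sum_card_cnbhd t (S : {set 'I_t}) :
  \sum_x #|S :&: cnbhd x| <= 3 * #|S|.
Proof.
have E x : #|S :&: cnbhd x| = \sum_(y in S) (x \in cnbhd y).
  rewrite -sum1_card big_mkcond [RHS]big_mkcond; apply: eq_bigr => y _ /=.
  by rewrite inE cnbhdC; case: (y \in S); case: (_ \in _).
rewrite (eq_bigr _ (fun x _ => E x)) exchange_big /= mulnC -sum_nat_const.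
apply: leq_sum => y _; apply: leq_trans (card_cnbhd y).
by rewrite -sum1_card [leqRHS]big_mkcond; apply: leq_sum => x _; case: (_ \in _).
Qed.

(** * Counting the pairs that are not free *)

Lemma sum_mul_sqr (T : finType) (a : T -> nat) :
  \sum_x \sum_y a x * a y = (\sum_x a x) ^ 2.
Proof.
rewrite -mulnn big_distrl /=; apply: eq_bigr => x _; by rewrite big_distrr.
Qed.

(** The second condition makes any colours chosen for [x] and [y] distinct; the third lets each set
    lose no more vertices than the two colours spent. *)
Definition free_pair n t (F : 'I_n -> {set 'I_t}) (x y : 'I_t) :=
  [&& y \notin cnbhd x, [forall k, ~~ ((x \in F k) && (y \in F k))] &
      [forall k, #|F k :&: cnbhd x| + #|F k :&: cnbhd y| <= 2]].

Lemma no_free_pair_bound n t (F : 'I_n -> {set 'I_t}) :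
  (forall i, indep_cycle (F i)) -> (forall i, #|F i| = n) ->
  (forall x y, ~~ free_pair F x y) -> 2 * t ^ 2 <= 11 * n ^ 3 + 6 * t.
Proof.
move=> indF cardF nofree.
pose a k (x : 'I_t) := #|F k :&: cnbhd x|.
pose c k (x : 'I_t) : nat := x \in F k.
(* Each way of failing to be free contributes at least 2: a common set or closeness by the explicit
   factor, an overloaded set by a product of two numbers at most 2 whose sum is at least 3. *)
pose w x y := \sum_k a k x * a k y + 2 * \sum_k c k x * c k y + 2 * (y \in cnbhd x).
have w2 x y : 2 <= w x y.
  have := nofree x y; rewrite /w !negb_and negbK => /or3P[->|/forallPn[k]|/forallPn[k]].
  - by rewrite leq_addl.
  - rewrite negbK => xyk; rewrite (bigD1 (P := predT) k) //= [in X in 2 * X](bigD1 k) //=.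
    by move: xyk; rewrite /c => /andP[-> ->]; lia.
  - rewrite (bigD1 k) //= -ltnNge -/(a k x) -/(a k y).
    have : a k x <= 2 by apply: card_indep_cnbhd.
    have : a k y <= 2 by apply: card_indep_cnbhd.
    move: (a k x) (a k y) => [|[|[|p]]] [|[|[|q]]] //; lia.
have lo : 2 * t ^ 2 <= \sum_x \sum_y w x y.
  apply: (@leq_trans (\sum_(x < t) \sum_(y < t) 2)); last by do 2![apply: leq_sum => ? _].
  by rewrite !sum_nat_const !card_ord; lia.
have sumswap (f : 'I_n -> 'I_t -> nat) :
    \sum_x \sum_y \sum_k f k x * f k y = \sum_k (\sum_x f k x) ^ 2.
  under eq_bigr do rewrite exchange_big.
  by rewrite exchange_big; apply: eq_bigr => k _; rewrite /= sum_mul_sqr.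
apply: leq_trans lo _.
have -> : \sum_x \sum_y w x y = \sum_k (\sum_x a k x) ^ 2
    + 2 * \sum_k (\sum_x c k x) ^ 2 + 2 * \sum_(x < t) \sum_y (y \in cnbhd x).
  rewrite -!sumswap !big_distrr -!big_split; apply: eq_bigr => x _ /=.
  by rewrite !big_distrr -!big_split.
(* The three totals are at most [9n^3], [n^3] and [3t]; the last two are doubled. *)
have A : \sum_k (\sum_x a k x) ^ 2 <= n * (3 * n) ^ 2.
  rewrite -[n in n * _]card_ord -sum_nat_const; apply: leq_sum => k _.
  by rewrite leq_exp2r //; have := sum_card_cnbhd (F k); rewrite cardF.
have C : \sum_k (\sum_x c k x) ^ 2 <= n * n ^ 2.
  rewrite -[n in n * _]card_ord -sum_nat_const; apply: leq_sum => k _.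
  rewrite leq_exp2r // -[leqRHS](cardF k) -sum1_card [leqRHS]big_mkcond.
  by apply: leq_sum => x _; rewrite /c; case: (_ \in _).
have B : \sum_(x < t) \sum_y (y \in cnbhd x) <= t * 3.
  rewrite -[t in t * _]card_ord -sum_nat_const; apply: leq_sum => x _.
  apply: leq_trans (card_cnbhd x); rewrite -sum1_card [leqRHS]big_mkcond.
  by apply: leq_sum => y _; case: (_ \in _).
by move: A B C; rewrite -!mulnn !expnS; lia.
Qed.

(** * Full rainbow independent sets in the cycle *)

Lemma rainbow_of_choice n t (F : 'I_n -> {set 'I_t}) (h : 'I_n -> 'I_t) :
  (forall i, h i \in F i) ->
  (forall i j, i != j -> (h i != h j) && ~~ cycle_adj (h i) (h j)) ->
  exists S : {set vertex (cycle_graph t)},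
    [/\ rainbow_set (F : 'I_n -> {set vertex (cycle_graph t)}) S, independent S & #|S| = n].
Proof.
move=> hF hsep.
have hinj : injective h.
  by move=> i j /eqP hij; apply: contraTeq hij => /hsep /andP[].
exists [set h j | j : 'I_n]; split.
- by exists n, id, h; split.
- move=> _ _ /imsetP[i _ ->] /imsetP[j _ ->] /=.
  have [->|/hsep/andP[]//] := eqVneq i j.
  by rewrite cycle_adj_irrefl.
- by rewrite card_imset // card_ord.
Qed.

Lemma rainbow_cycle n t :
  11 * n ^ 3 + 6 * t < 2 * t ^ 2 -> rainbow_property (cycle_graph t) n n n.
Proof.
move=> hnt F FP.
have indF i : indep_cycle (F i) by case: (FP i).
have cardF i : #|F i| = n by case: (FP i).
have [/existsP[x /forallP xF]|] := boolP [exists x, forall i, x \notin F i].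
  have [i _|g [gF gsep]] := @rainbow_cycle_minus_vertex _ t x [set: 'I_n] F.
    by split; rewrite ?xF // cardsT card_ord cardF.
  by apply: (rainbow_of_choice (h := g)) => [i|i j]; [apply: gF | apply: gsep].
rewrite negb_exists => /forallP cov.
have {}cov x : exists i, x \in F i.
  by have /forallPn[i] := cov x; rewrite negbK; exists i.
have [/existsP[x /existsP[y]]|nofree] := boolP [exists x, exists y, free_pair F x y]; last first.
  have /(no_free_pair_bound indF cardF) : forall x y, ~~ free_pair F x y.
    by move=> x y; apply: contra nofree => xy; apply/existsP; exists x; apply/existsP; exists y.
  by rewrite leqNgt hnt.
case/and3P=> yNx /forallP disj /forallP load.
have [[k xk] [l yl]] := (cov x, cov y).
have kl : k != l by apply: contraTneq (disj k) => E; rewrite xk E yl.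
pose K := ~: [set k; l].
have cardK : #|K| = n - 2 by have := cardsC [set k; l]; rewrite cards2 kl card_ord /K; lia.
(* Deleting both neighbourhoods removes [x] from every set, so the cycle can be opened at [x] for
   the remaining [n - 2] colours. *)
pose G i := F i :\: (cnbhd x :|: cnbhd y).
have xG i : x \notin G i by rewrite !inE eqxx.
have [i _|g [gG gsep]] := @rainbow_cycle_minus_vertex _ t x K G.
  split=> //.
    by move=> u v /setDP[uF _] /setDP[vF _]; apply: indF uF vF.
  rewrite cardK cardsD cardF setIUr leq_sub2l //.
  by apply: leq_trans (load i); rewrite cardsU leq_subr.
have gK i : i != k -> i != l -> [/\ i \in K, g i \in F i, g i \notin cnbhd x & g i \notin cnbhd y].
  move=> ik il; have iK : i \in K by rewrite !inE negb_or ik.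
  by have := gG _ iK; rewrite in_setD in_setU negb_or -andbA => /and3P[? ? ?].
have sepN u v : u \notin cnbhd v -> (v != u) && ~~ cycle_adj v u.
  by rewrite !inE negb_or eq_sym.
have sepN' u v : u \notin cnbhd v -> (u != v) && ~~ cycle_adj u v.
  by rewrite cnbhdC; apply: sepN.
pose h i := if i == k then x else if i == l then y else g i.
apply: (rainbow_of_choice (h := h)) => [i|i j ij]; rewrite /h.
  by case: (eqVneq i k) => [->//|ik]; case: (eqVneq i l) => [->//|il]; case: (gK i).
move: ij; case: (eqVneq i k) => [->|ik]; case: (eqVneq j k) => [_|jk] //.
- by case: (eqVneq j l) => [_ _|jl _]; apply: sepN => //; case: (gK j).
- by case: (eqVneq i l) => [_ _|il _]; apply: sepN' => //; case: (gK i).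
case: (eqVneq i l) => [->|il]; case: (eqVneq j l) => [_|jl] //.
- by move=> _; apply: sepN; case: (gK j).
- by move=> _; apply: sepN'; case: (gK i).
by apply: gsep; [case: (gK i) | case: (gK j)].
Qed.

(** * The lower bound *)

Lemma card_rainbow_set (T : finType) k (F : 'I_k -> {set T}) (S : {set T}) :
  rainbow_set F S -> #|S| <= k.
Proof.
case=> m [i [x [imono _ _ ->]]].
have iinj : injective i.
  move=> a b iab; apply/eqP; rewrite -val_eqE /=.
  by case: ltngtP => // /imono; rewrite iab ltnn.
apply: leq_trans (leq_imset_card _ _) _.
by rewrite -[leqRHS]card_ord; apply: leq_card iinj.
Qed.

(** Take the vertices [0, 2, ..., 2n - 2]; since [2i + 1 < t], their successors do not wrap
    around. *)
Lemma exists_indep_cycle n t : 2 * n < t ->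
  exists S : {set 'I_t}, indep_cycle S /\ #|S| = n.
Proof.
move=> nt; have dlt (i : 'I_n) : 2 * i < t by have := ltn_ord i; lia.
pose d i := Ordinal (dlt i).
exists [set d i | i : 'I_n]; split.
  move=> _ _ /imsetP[i _ ->] /imsetP[j _ ->].
  rewrite /cycle_adj -!val_eqE /=; have := ltn_ord i; have := ltn_ord j.
  by move=> jn in_; rewrite !modn_small; lia.
rewrite card_imset ?card_ord // => i j /(congr1 val) /= ij.
by apply: val_inj => /=; lia.
Qed.

(** Repeat [S] in all [k] places: a rainbow set uses each index at most once, so it has at most [k]
    elements. *)
Lemma rainbow_property_ge n m k (G : sgraph) (S : {set vertex G}) :
  independent S -> #|S| = n -> rainbow_property G n m k -> m <= k.
Proof.
move=> indS cardS /(_ (fun=> S)) [//|S' [/card_rainbow_set + _ <-]] //.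
Qed.

(** * The numerical estimate and the conclusion *)

Local Open Scope ring_scope.

Lemma size_bound (n t : rat) : 1 <= n -> 1 / 3 * n ^+ 2 + 44 / 9 * n < t ->
  11 * n ^+ 3 + 6 * t < 2 * t ^+ 2.
Proof.
move=> n1; set u := (X in X < _) => ut.
(* From 3 on, [2s^2 - 6s] increases with [s], so [t] may be replaced by the threshold [u]. *)
have u3: 3 <= u by rewrite /u; nra.
have mono: 2 * u ^+ 2 - 6 * u <= 2 * t ^+ 2 - 6 * t by nra.
suff: 11 * n ^+ 3 + 6 * u < 2 * u ^+ 2 by lra.
rewrite /u -subr_gt0.
(* At [u], the difference of the two sides is [n / 81] times this cubic, which equals [n - 1] times
   the quadratic below plus [18n^2 + 1516n - 545]. *)
have q : 0 < 18 * n^+ 2 * n - 363 * n^+ 2 + 3710 * n - 2376.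
  have : 0 <= 18 * n ^+ 2 - 363 * n + 1831 by have := sqr_ge0 (36 * n - 363); lra.
  nra.
have := mulr_gt0 (lt_le_trans ltr01 n1) q; lra.
Qed.

Theorem theorem1p7 (n t : nat) (hn : (0 < n)%N) (ht : (0 < t)%N)
    (hnt : 1 / 3 * n%:R ^+ 2 + 44 / 9 * n%:R < t%:R :> rat) :
  is_rainbow_f (cycle_graph t) n n n.
Proof.
have n1 : 1 <= n%:R :> rat by rewrite ler1n.
split.
  by apply: rainbow_cycle; rewrite -(ltr_nat rat) !(natrD, natrM, natrX); apply: size_bound.
have [|S [indS cardS]] := @exists_indep_cycle n t.
  rewrite -(ltr_nat rat) natrM; nra.
move=> j jn /(rainbow_property_ge (indS : independent (G := cycle_graph t) S) cardS).
by rewrite leqNgt jn.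
Qed.
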